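(* To break ties, suppose that VAIL outputs a policy $\pi^{\mathrm{AIL}}$ uniformly sampled from all optimal solutions of $$\min_{\pi\in\Pi}\sum_{h=1}^H\sum_{(s,a)\in\mathcal S\times\mathcal A}\bigl|P^\pi_h(s,a)-\widehat P^{\pi^{E}}_h(s,a)\bigr|.$$ There exists a tabular and episodic MDP satisfying the Standard Imitation assumption such that, to obtain an $\varepsilon$-optimal policy (i.e., $V^{\pi^{E}}-\mathbb E[V^{\pi^{\mathrm{AIL}}}]\le\varepsilon$), in expectation, VAIL requires at least $\Omega(|\mathcal S|H^2/\varepsilon^2)$ expert trajectories.
   Context: A tabular episodic MDP is a tuple $(\mathcal S,\mathcal A,P,r,H,\rho)$ with finite $\mathcal S,\mathcal A$, horizon $H$, time-dependent transitions $P_h(s'|s,a)$, rewards $r_h:\mathcal S\times\mathcal A\to[0,1]$, and initial state distribution $\rho$. $\Pi$ is the set of all non-stationary stochastic policies $\pi=(\pi_1,\dots,\pi_H)$, $\pi_h:\mathcal S\to\Delta(\mathcal A)$. $V^\pi$ is the expected total reward over $H$ steps; $P^\pi_h(s,a)$ is the probability that $(s_h,a_h)=(s,a)$ under $\pi$. The expert $\pi^{E}$ is deterministic; the dataset $\mathcal D$ consists of i.i.d. length-$H$ trajectories of $\pi^{E}$ (the expert trajectories); $\widehat P^{\pi^{E}}_h(s,a)$ is the fraction of trajectories in $\mathcal D$ with $(s_h,a_h)=(s,a)$. The expectation is over the random dataset and the random selection of $\pi^{\mathrm{AIL}}$. Standard Imitation assumption: each state is absorbing and each action has the same transitions, i.e.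 $P_h(s|s,a)=1$ for all $(s,a)\in\mathcal S\times\mathcal A$ and $h\in\{1,\dots,H\}$; and for any state, $a^1$ is the expert action with reward $1$ and the other actions are non-expert actions with reward $0$. *)

(* Defs.v *)
(* MathComp / MathComp-Analysis. *)
From HB Require Import structures.
From mathcomp Require Import all_boot all_order all_algebra.
From mathcomp Require Import all_classical all_reals all_analysis.

Set Implicit Arguments.
Unset Strict Implicit.
Unset Printing Implicit Defensive.

Import Order.TTheory GRing.Theory Num.Theory.
Import numFieldNormedType.Exports.

Local Open Scope classical_set_scope.
Local Open Scope ring_scope.

Definition is_distr (R : realType) (T : finType) (p : T -> R) : Prop :=
  (forall x, 0 <= p x) /\ \sum_x p x = 1.

(* Step h of the horizon is the ordinal h.-1, so steps are 0, ..., H.-1. The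
   kernel of the last step is part of the data, but no trajectory uses it. *)
Record mdp (R : realType) (S A : finType) (H : nat) : Type := MDP {
  trans : 'I_H -> S -> A -> S -> R;
  reward : 'I_H -> S -> A -> R;
  init : S -> R;
  trans_distr : forall h s a, is_distr (trans h s a);
  reward_01 : forall h s a, 0 <= reward h s a <= 1;
  init_distr : is_distr init }.

Section UniformLaw.
Variable R : realType.

(* Lebesgue measure on R^k; R^0 is a point of mass 1. *)
Fixpoint lebesgue_tuple (k : nat) : set (k.-tuple (measurableTypeR R)) -> \bar R :=
  match k with
  | 0 => fun B => \d_([tuple] : 0.-tuple (measurableTypeR R)) B
  | k'.+1 => fun B =>
      (@lebesgue_measure R \x @lebesgue_tuple k')%E
        [set xt : measurableTypeR R * k'.-tuple (measurableTypeR R)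
           | B [tuple of xt.1 :: xt.2]]
  end.

Variable X : finType.

Definition affine_chart (k : nat) (p0 : X -> R) (e : 'I_k -> X -> R)
    (t : k.-tuple (measurableTypeR R)) : X -> R :=
  fun x => p0 x + \sum_(i < k) tnth t i * e i x.

Definition cylinders : set (set (X -> R)) :=
  [set C | exists x : X, exists2 B : set (measurableTypeR R),
     measurable B & C = [set p | B (p x)]].

(* R^X with its product (i.e. Borel) sigma-algebra *)
Definition RX : measurableType cylinders.-sigma :=
  g_sigma_algebraType cylinders.

(* The uniform law on a bounded convex subset K of R^X, which may have empty
   interior: K is seen in an affine chart of some dimension k where it has
   positive and finite volume (so the chart spans the affine hull of K), and
   the law is normalized k-dimensional volume. Another choice of chart rescales
   numerator and denominator by the same Jacobian; when K is a point, k = 0 and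
   the law is the Dirac mass. *)
Definition uniform_on (K : set (X -> R)) (mu : probability RX R) : Prop :=
  exists (k : nat) (p0 : X -> R) (e : 'I_k -> X -> R),
    let phi := affine_chart p0 e in
    [/\ injective phi,
        K `<=` range phi,
        (0 < lebesgue_tuple (phi @^-1` K) < +oo)%E &
        forall B : set RX, measurable B ->
          mu B = (lebesgue_tuple (phi @^-1` (K `&` B)) /
                  lebesgue_tuple (phi @^-1` K))%E].

End UniformLaw.

Section ImitationLearning.
Variables (R : realType) (S A : finType) (H : nat).

(* pi (h, s, a) is the probability that pi_h gives to a in state s; being a
   policy is the predicate is_policy. *)
Definition policy := 'I_H * S * A -> R.

Definition is_policy (pi : policy) : Prop :=
  forall h s, is_distr (fun a => pi (h, s, a)).

Definition det_policy (f : 'I_H -> S -> A) : policy :=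
  fun x => let: (h, s, a) := x in (a == f h s)%:R.

Definition traj := {ffun 'I_H -> S * A}.

Definition policy_law := probability (RX R ('I_H * S * A)%type) R.

Variable M : mdp R S A H.

Definition traj_prob (pi : policy) (t : traj) : R :=
  (\prod_(h < H | h == 0 :> nat) init M (t h).1) *
  (\prod_(h < H) pi (h, (t h).1, (t h).2)) *
  (\prod_(h < H) \prod_(h' < H | h' == h.+1 :> nat)
      trans M h (t h).1 (t h).2 (t h').1).

Definition occupancy (pi : policy) (h : 'I_H) (s : S) (a : A) : R :=
  \sum_(t : traj | t h == (s, a)) traj_prob pi t.

Definition value (pi : policy) : R :=
  \sum_(t : traj) traj_prob pi t * \sum_(h < H) reward M h (t h).1 (t h).2.

Definition data_prob (piE : policy) (n : nat) (D : n.-tuple traj) : R :=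
  \prod_(i < n) traj_prob piE (tnth D i).

Definition empirical (n : nat) (D : n.-tuple traj) (h : 'I_H) (s : S) (a : A)
    : R :=
  (count (fun t : traj => t h == (s, a)) D)%:R / n%:R.

Definition vail_loss (n : nat) (D : n.-tuple traj) (pi : policy) : R :=
  \sum_(h < H) \sum_(sa : S * A)
    `|occupancy pi h sa.1 sa.2 - empirical D h sa.1 sa.2|.

Definition vail_solutions (n : nat) (D : n.-tuple traj) : set policy :=
  [set pi | is_policy pi /\
     forall pi', is_policy pi' -> vail_loss D pi <= vail_loss D pi'].

Definition is_vail (n : nat)
    (alg : n.-tuple traj -> policy_law) : Prop :=
  forall D, uniform_on (vail_solutions D) (alg D).

(* Given the data D, the output policy has law alg D. *)
Definition expected_value (piE : policy) (n : nat)
    (alg : n.-tuple traj -> policy_law) : R :=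
  \sum_(D : n.-tuple traj)
    data_prob piE D * (\int[alg D]_pi value pi).

Definition standard_imitation (expert : 'I_H -> S -> A) : Prop :=
  (forall h s a, trans M h s a s = 1) /\
  exists a1 : A, forall h s,
    [/\ expert h s = a1, reward M h s a1 = 1 &
        forall a, a != a1 -> reward M h s a = 0].

End ImitationLearning.

(* Main.v *)
(* Take the uniform initial law rho on S, frozen states and reward 1 for a1 only.
   On data D the VAIL loss splits over pairs (h, s), and its solutions are the
   policies with rho * pi_h(a1|s) >= min(rho, e_h(s)), where e is the empirical
   law. Exchanging the excess of pi_h(a1|s) over its lower bound with pi_h(a2|s)
   is an affine involution of this polytope, so it preserves the uniform law and
   the mean of pi_h(a1|s) is at most (1 + e_h(s)/rho)/2 when e_h(s) <= rho. Hence
   the expected gap is at least the sum over (h, s) of E[(rho - e_h(s))^+]/2, and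
   a fourth moment bound shows that each term is at least a constant times
   sqrt(rho/n), or rho/4 if n is small: the gap is of order H sqrt(|S|/n). *)
Require Import Defs.
From HB Require Import structures.
From mathcomp Require Import all_boot all_order all_algebra.
From mathcomp Require Import all_classical all_reals all_analysis measurable_realfun.
From mathcomp Require Import ring lra.
Import Order.TTheory GRing.Theory Num.Theory.
Import numFieldNormedType.Exports.

Set Implicit Arguments.
Unset Strict Implicit.
Unset Printing Implicit Defensive.

Local Open Scope classical_set_scope.
Local Open Scope ring_scope.

(** * Lebesgue measure on tuples *)

(* A named structure, because unification cannot infer the proof [mf]. *)
Definition pushforward_measure d d' (T1 : measurableType d) (T2 : measurableType d')
    (R : realFieldType) (m : {measure set T1 -> \bar R}) (f : T1 -> T2)
    (mf : measurable_fun setT f) : {measure set T2 -> \bar R} :=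
  measure_function_pushforward__canonical__measure_function_Measure m mf.

Section TranslationInvariance.
Context {R : realType}.
Implicit Types k : nat.

Definition tuple_add k (u t : k.-tuple (measurableTypeR R)) :
    k.-tuple (measurableTypeR R) := [tuple (tnth u i : R) + tnth t i | i < k].

Definition tuple_opp k (t : k.-tuple (measurableTypeR R)) :
    k.-tuple (measurableTypeR R) := [tuple - (tnth t i : R) | i < k].

Lemma measurable_tuple_add k :
  measurable_fun setT (fun x : k.-tuple (measurableTypeR R) *
     k.-tuple (measurableTypeR R) => tuple_add x.1 x.2).
Proof.
apply/measurable_fun_tnthP => i /=.
rewrite (_ : _ \o _ = fun x => (tnth x.1 i : R) + tnth x.2 i); last first.
  by apply/funext => x /=; rewrite tnth_mktuple.
apply: measurable_funD.
  exact: (measurableT_comp (measurable_tnth i) measurable_fst).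
exact: (measurableT_comp (measurable_tnth i) measurable_snd).
Qed.

Lemma measurable_tuple_opp k : measurable_fun setT (@tuple_opp k).
Proof.
apply/measurable_fun_tnthP => i /=.
rewrite (_ : _ \o _ = fun x => - (tnth x i : R)); last first.
  by apply/funext => x /=; rewrite tnth_mktuple.
exact: (measurableT_comp (@oppr_measurable R setT) (measurable_tnth i)).
Qed.

Lemma measurable_tuple_addl k (u : k.-tuple (measurableTypeR R)) :
  measurable_fun setT (tuple_add u).
Proof.
exact: (measurableT_comp (@measurable_tuple_add k) (pair1_measurable u)).
Qed.

(** Lebesgue measure is determined by its values on half-open intervals, and a translation keeps
    their length. *)
Lemma lebesgue_measure_translation (u : R) (B : set (measurableTypeR R)) :
  measurable B -> lebesgue_measure [set x : R | B (u + x)] = lebesgue_measure B.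
Proof.
move=> mB.
have mu : measurable_fun setT (fun x : measurableTypeR R => (u + x : measurableTypeR R)).
  exact: measurable_funD.
pose nu : {measure set (measurableTypeR R) -> \bar R} :=
   pushforward_measure
     (@lebesgue_measure R) mu.
apply/esym.
apply: (@lebesgue_measure_unique R nu) => //= _ [[a b]] _ <-.
rewrite /pushforward /=.
rewrite (_ : _ @^-1` _ = `]a - u, b - u]%classic); last first.
  by apply/seteqP; split => x /=; rewrite !in_itv /= ltrBlDl lerBrDl.
rewrite !lebesgue_measure_itv /= !lte_fin ltrD2r.
by case: ifP => // _; rewrite -!EFinB; congr _%:E; ring.
Qed.

Definition cons_pair k (xt : measurableTypeR R * k.-tuple (measurableTypeR R)) :
  k.+1.-tuple (measurableTypeR R) := [tuple of xt.1 :: xt.2].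

Lemma measurable_cons_pair k : measurable_fun setT (@cons_pair k).
Proof. exact: measurable_cons. Qed.

Lemma measurable_uncons k :
  measurable_fun setT (fun t : k.+1.-tuple (measurableTypeR R) =>
    (thead t, [tuple of behead t])).
Proof.
apply/measurable_fun_pairP; split; first exact: measurable_tnth.
exact: measurable_behead.
Qed.

(** Both exhaustions are taken increasing, so that a point lies in the rectangle [F n] times [G n]
    at the larger of its two indices. *)
Lemma sigma_finite_product d1 d2 (T1 : measurableType d1) (T2 : measurableType d2)
    (m1 : {sigma_finite_measure set T1 -> \bar R})
    (m2 : {sigma_finite_measure set T2 -> \bar R}) :
  sigma_finite setT (m1 \x m2)%E.
Proof.
have /sigma_finiteP[F [FT ndF mF]] := sigma_finiteT m1.
have /sigma_finiteP[G [GT ndG mG]] := sigma_finiteT m2.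
exists (fun n => F n `*` G n).
  apply/esym/seteqP; split=> // -[x y] _.
  have [n _ Fx] : (\bigcup_n F n) x by rewrite -FT.
  have [m _ Gy] : (\bigcup_n G n) y by rewrite -GT.
  exists (maxn n m) => //; split=> /=.
    by have /subsetPset := ndF _ _ (leq_maxl n m); apply.
  by have /subsetPset := ndG _ _ (leq_maxr n m); apply.
move=> n; have [mFn Fn] := mF n; have [mGn Gn] := mG n.
split; first exact: measurableX.
by rewrite product_measure1E // lte_mul_pinfty // ge0_fin_numE.
Qed.

(** [lebesgue_tuple] is defined as a bare set function. This supplies its structure of sigma-finite
    measure: each successor step is the image of a product measure under [cons_pair]. *)
Lemma lebesgue_tuple_measure k :
  exists mu : {sigma_finite_measure set (k.-tuple (measurableTypeR R)) -> \bar R},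
    @lebesgue_tuple R k = mu.
Proof.
elim: k => [|k [mu muE]]; first by exists (\d_([tuple] : 0.-tuple (measurableTypeR R))).
pose lam := (@lebesgue_measure R \x mu)%E.
pose nu : {measure set (k.+1.-tuple (measurableTypeR R)) -> \bar R} :=
   pushforward_measure
     lam (@measurable_cons_pair k).
have nu_sf : sigma_finite setT nu.
  have [F FT mF] := sigma_finite_product (@lebesgue_measure R) mu.
  exists (fun n => (fun t : k.+1.-tuple (measurableTypeR R) =>
    (thead t, [tuple of behead t])) @^-1` F n).
    by rewrite -preimage_bigcup -FT preimage_setT.
  move=> n; have [mFn lFn] := mF n; split.
    by rewrite -[X in measurable X]setTI; exact: measurable_uncons.
  rewrite /nu /= /pushforward -comp_preimage.
  rewrite (_ : _ \o _ = id) //; apply/funext => -[x t] /=; congr pair.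
  by apply/val_inj.
pose mix := @Measure_isSigmaFinite.Build _ _ _ nu nu_sf.
pose nu' : {sigma_finite_measure set (k.+1.-tuple (measurableTypeR R)) -> \bar R} :=
  HB.pack (nu : set _ -> \bar R) (Measure.on nu) mix.
exists nu'.
by apply/funext => B /=; rewrite muE.
Qed.

(** Induction on k. The translate of the product measure agrees with it on rectangles, by the
    one-dimensional case and the induction hypothesis, and rectangles determine a product
    measure. *)
Lemma lebesgue_tuple_translation k (u : k.-tuple (measurableTypeR R))
    (B : set (k.-tuple (measurableTypeR R))) : measurable B ->
  lebesgue_tuple (tuple_add u @^-1` B) = lebesgue_tuple B.
Proof.
elim: k u B => [|k IH] u B mB.
  by congr lebesgue_tuple; apply/seteqP; split => x /=; rewrite (tuple0 (tuple_add _ _)) (tuple0 x).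
have [mu muE] := lebesgue_tuple_measure k.
rewrite /= muE.
pose f (xt : measurableTypeR R * k.-tuple (measurableTypeR R)) :
    measurableTypeR R * k.-tuple (measurableTypeR R) :=
  ((thead u + xt.1 : R), tuple_add [tuple of behead u] xt.2).
have mf : measurable_fun setT f.
  apply/measurable_fun_pairP; split; first exact: measurable_funD.
  exact: (measurableT_comp (measurable_tuple_addl _) measurable_snd).
pose lam := (@lebesgue_measure R \x mu)%E.
pose nu : {measure set (measurableTypeR R * k.-tuple (measurableTypeR R)) -> \bar R} :=
   pushforward_measure lam mf.
rewrite [RHS](@product_measure_unique _ _ _ _ _ _ _ nu); first last.
- by rewrite -[X in measurable X]setTI; exact: measurable_cons_pair.
- move=> C D mC mD; rewrite /nu /= /pushforward.
  rewrite (_ : f @^-1` _ =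
     [set x : R | C (thead u + x)] `*` (tuple_add [tuple of behead u] @^-1` D)) //.
  rewrite product_measure1E//; last 2 first.
  + rewrite -[X in measurable X]setTI.
    exact: (@measurable_funD _ _ _ _ (cst (thead u)) id).
  + by rewrite -[X in measurable X]setTI; exact: measurable_tuple_addl.
  congr (_ * _)%E; first exact: lebesgue_measure_translation.
  by rewrite /= -muE; exact: IH.
transitivity ((@lebesgue_measure R \x mu)%E ([set xt | B (cons_pair (f xt))])); last by [].
congr ((_ \x _)%E _); apply/funext => -[x t] /=; congr B.
apply/eq_from_tnth => i; rewrite tnth_mktuple.
case: (unliftP ord0 i) => [j ->|->]; last by rewrite !tnth0.
rewrite !tnthS tnth_mktuple tnth_behead (_ : inord _ = lift ord0 j) //.
by apply/val_inj; rewrite /= inordK // ltnS.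
Qed.

End TranslationInvariance.

(** * Affine involutions and translation-invariant measures *)

Section Involution.
Context {R : realType}.
Implicit Types k : nat.

Definition translation_invariant k
    (mu : set (k.-tuple (measurableTypeR R)) -> \bar R) :=
  forall u B, measurable B -> mu (tuple_add u @^-1` B) = mu B.

Lemma tuple_addC k (u t : k.-tuple (measurableTypeR R)) :
  tuple_add u t = tuple_add t u.
Proof. by apply/eq_from_tnth => i; rewrite !tnth_mktuple addrC. Qed.

Lemma tuple_addKl k (u t : k.-tuple (measurableTypeR R)) :
  tuple_add (tuple_opp u) (tuple_add u t) = t.
Proof. by apply/eq_from_tnth => i; rewrite !tnth_mktuple addKr. Qed.

(* Both sides are the (lam \x nu)-measure of {(x, y) | A x /\ B (x + y)}: slice
   it along x, or shift x by - y and slice along y. *)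
Lemma invariant_measures_exchange k
    (lam nu : {sigma_finite_measure set (k.-tuple (measurableTypeR R)) -> \bar R})
    (A B : set (k.-tuple (measurableTypeR R))) :
  translation_invariant lam -> translation_invariant nu ->
  measurable A -> measurable B ->
  (lam A * nu B = lam B * nu (@tuple_opp R k @^-1` A))%E.
Proof.
move=> lamT nuT mA mB.
pose TT : Type := (k.-tuple (measurableTypeR R) * k.-tuple (measurableTypeR R))%type.
pose C : set TT := [set xy | A xy.1 /\ B (tuple_add xy.1 xy.2)].
pose C' : set TT := [set xy | A (tuple_add (tuple_opp xy.2) xy.1) /\ B xy.1].
have mnA : measurable (@tuple_opp R k @^-1` A).
  by rewrite -[X in measurable X]setTI; exact: measurable_tuple_opp.
have mC : measurable C.
  apply: measurableI.
    by rewrite -[X in measurable X]setTI; exact: measurable_fst.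
  by rewrite -[X in measurable X]setTI; exact: measurable_tuple_add.
have mC' : measurable C'.
  apply: measurableI; last first.
    by rewrite -[X in measurable X]setTI; exact: measurable_fst.
  have mg : measurable_fun setT (fun xy : TT => (tuple_opp xy.2, xy.1)).
    apply/measurable_fun_pairP; split=> /=; last exact: measurable_fst.
    exact: (measurableT_comp (@measurable_tuple_opp R k) measurable_snd).
  have madd := measurableT_comp (@measurable_tuple_add R k) mg.
  by rewrite -[X in measurable X]setTI; exact: madd.
(* Tonelli for indicators: [\x] integrates the slices along the first variable, [\x^] along the
   second. *)
have swap (X : set TT) : measurable X -> (lam \x nu)%E X = (lam \x^ nu)%E X.
  move=> mX; apply: product_measure_unique => // D E mD mE.
  exact: product_measure2E.
transitivity ((lam \x nu)%E C).
  rewrite /product_measure1 (eq_integral (fun x => (\1_A x)%:E * nu B)%E) => [|x _].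
    by rewrite ge0_integralZr ?integral_indic ?setIT//; exact: measurableT_comp.
  rewrite indicE /=; have [xA|xA] := boolP (x \in A).
    rewrite mul1e -(nuT x B mB); congr (nu _); apply/seteqP.
    by split=> y; rewrite /xsection /= inE /C /=; [case|split=> //; exact: set_mem].
  rewrite mul0e (_ : xsection _ _ = set0) ?measure0 // -subset0 => y.
  by rewrite /xsection /= inE => -[/mem_set]; rewrite (negPf xA).
rewrite swap //.
transitivity ((lam \x nu)%E C').
  rewrite swap //; apply: eq_integral => y _ /=.
  rewrite -[RHS](lamT y); last exact: measurable_ysection.
  congr (lam _); apply/seteqP.
  by split=> x; rewrite /ysection /= !inE /C /C' /= tuple_addKl tuple_addC.
rewrite /product_measure1
  (eq_integral (fun x => (\1_B x)%:E * nu (@tuple_opp R k @^-1` A))%E) => [|x _].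
  by rewrite ge0_integralZr ?integral_indic ?setIT//; exact: measurableT_comp.
rewrite indicE /=; have [xB|xB] := boolP (x \in B).
  rewrite mul1e -(nuT (tuple_opp x) _ mnA); congr (nu _); apply/seteqP.
  have oppE y : tuple_opp (tuple_add (tuple_opp x) y) = tuple_add (tuple_opp y) x.
    by apply/eq_from_tnth => i; rewrite !tnth_mktuple; ring.
  split=> y; rewrite /xsection /= inE /C' /= oppE; first by case.
  by split=> //; exact: set_mem.
rewrite mul0e (_ : xsection _ _ = set0) ?measure0 // -subset0 => y.
by rewrite /xsection /= inE => -[_ /mem_set]; rewrite (negPf xB).
Qed.

Lemma mule_fin_cancel (x y : \bar R) (z : \bar R) :
  (0 < z < +oo)%E -> (x * z = y * z)%E -> x = y.
Proof.
move=> /andP[z0 zy]; have zfin : z \is a fin_num by rewrite ge0_fin_numE // ltW.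
move: z0; rewrite -(fineK zfin) lte_fin => z0.
move=> /(congr1 (fun e => (e * (fine z)^-1%:E)%E)).
by rewrite -!muleA -EFinM divff ?gt_eqF // !mule1.
Qed.

(** This replaces a determinant computation. The image nu of mu under T is again translation
    invariant, and nu K = mu K. The exchange identity for (E, K) gives nu (- E) = mu E. The one for
    (K, B) then gives nu B = mu B. *)
Lemma invariant_involution k
    (mu : {sigma_finite_measure set (k.-tuple (measurableTypeR R)) -> \bar R})
    (T L : k.-tuple (measurableTypeR R) -> k.-tuple (measurableTypeR R))
    (K : set (k.-tuple (measurableTypeR R))) :
  translation_invariant mu ->
  measurable_fun setT T -> involutive T ->
  (forall u t, T (tuple_add u t) = tuple_add (L u) (T t)) ->
  measurable K -> T @^-1` K = K -> (0 < mu K < +oo)%E ->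
  forall B, measurable B -> mu (T @^-1` B) = mu B.
Proof.
move=> muT mT TK TL mK KT muK B mB.
(* Applying T twice to u + u gives u + u = L (L u) + u, from which u cancels. *)
have LK u : L (L u) = u.
  have := TL (L u) (T u); rewrite -TL !TK => /(congr1 (@tnth _ _)) LLu; apply/eq_from_tnth => i.
  by have := congr1 (fun f => f i) LLu; rewrite !tnth_mktuple => /addIr/esym.
have mTpre X : measurable X -> measurable (T @^-1` X).
  by move=> mX; rewrite -[X in measurable X]setTI; exact: mT.
pose nu0 : {measure set (k.-tuple (measurableTypeR R)) -> \bar R} :=
   pushforward_measure mu mT.
have nu_sf : sigma_finite setT nu0.
  have [F FT mF] := sigma_finiteT mu; exists (fun n => T @^-1` F n).
    by rewrite -preimage_bigcup -FT preimage_setT.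
  move=> n; have [mFn Fn] := mF n; split; first exact: mTpre.
  have TTF : T @^-1` (T @^-1` F n) = F n by apply/seteqP; split=> x /=; rewrite TK.
  by rewrite /nu0 /= /pushforward TTF.
pose mix := @Measure_isSigmaFinite.Build _ _ _ nu0 nu_sf.
pose nu : {sigma_finite_measure set (k.-tuple (measurableTypeR R)) -> \bar R} :=
  HB.pack (nu0 : set _ -> \bar R) (Measure.on nu0) mix.
have nuE X : nu X = mu (T @^-1` X) by [].
have nuT : translation_invariant nu.
  move=> u X mX; rewrite !nuE.
  have -> : T @^-1` (tuple_add u @^-1` X) = tuple_add (L u) @^-1` (T @^-1` X).
    by apply/seteqP; split=> t /=; rewrite TL LK.
  by apply: muT; exact: mTpre.
have opp E : measurable E -> nu (@tuple_opp R k @^-1` E) = mu E.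
  move=> mE; have := invariant_measures_exchange muT nuT mE mK.
  rewrite [nu K]nuE KT [RHS]muleC => /mule_fin_cancel -> //.
have := invariant_measures_exchange muT nuT mK mB.
by rewrite opp // muleC => /mule_fin_cancel <-.
Qed.

End Involution.

(** * Symmetries of the uniform law *)

Section UniformSwap.
Context {R : realType} {X : finType}.
Implicit Types (p : X -> R) (K : set (X -> R)).

Lemma measurable_RX_coord x : measurable_fun setT (fun p : RX R X => p x : R).
Proof.
move=> _ B mB; rewrite setTI; apply: sub_sigma_algebra.
by exists x; exists B.
Qed.

Lemma measurable_fun_RX d (T : measurableType d) (f : T -> RX R X) :
  (forall x, measurable_fun setT (fun t => f t x : R)) -> measurable_fun setT f.
Proof.
move=> mf; apply: (@measurability _ _ _ _ setT f (@cylinders R X)) => //.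
by move=> _ [_ [x [B mB ->]] <-]; exact: mf.
Qed.

(* The oblique reflection that exchanges [p x1 - q] and [p x2]. *)
Definition coord_swap (x1 x2 : X) (q : R) (p : X -> R) : X -> R :=
  fun x => p x - (p x1 - p x2 - q) * ((x == x1)%:R - (x == x2)%:R).

Lemma measurable_coord_swap x1 x2 q :
  measurable_fun setT (coord_swap x1 x2 q : RX R X -> RX R X).
Proof.
apply: measurable_fun_RX => x; rewrite /coord_swap.
apply: measurable_funB; first exact: measurable_RX_coord.
apply: measurable_funM => //; apply: measurable_funB => //.
by apply: measurable_funB; exact: measurable_RX_coord.
Qed.

Section Swap.
Variables (x1 x2 : X) (q : R).
Hypothesis x12 : x1 != x2.
Local Notation swap := (coord_swap x1 x2 q).

Lemma coord_swap1 p : swap p x1 = p x2 + q.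
Proof. by rewrite /coord_swap eqxx (negPf x12) subr0 mulr1; ring. Qed.

Lemma coord_swap2 p : swap p x2 = p x1 - q.
Proof. by rewrite /coord_swap eqxx eq_sym (negPf x12) sub0r mulrN1; ring. Qed.

Lemma coord_swap_other p x : x != x1 -> x != x2 -> swap p x = p x.
Proof. by move=> /negPf xx1 /negPf xx2; rewrite /coord_swap xx1 xx2 subrr mulr0 subr0. Qed.

Lemma coord_swapK : involutive swap.
Proof.
move=> p; apply/funext => x; rewrite [LHS]/coord_swap coord_swap1 coord_swap2.
by rewrite /coord_swap; ring.
Qed.

(** Read in the chart [phi], the swap becomes an affine involution T of the parameter space that
    preserves the preimage of K. That preimage has positive finite volume, so T preserves Lebesgue
    measure. *)
Lemma uniform_on_swap K (mu : probability (RX R X) R) :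
  measurable (K : set (RX R X)) -> (forall p, K p -> K (swap p)) ->
  (exists2 p, K p & p x1 - p x2 != q) -> uniform_on K mu ->
  forall B : set (RX R X), measurable B -> mu (swap @^-1` B) = mu B.
Proof.
move=> mK Kswap [p0 Kp0 p0q] [k [c [e]]].
set phi := affine_chart c e => -[_ Kphi lK muE] B mB.
have [lam lamE] := @lebesgue_tuple_measure R k.
have mphi : measurable_fun setT (phi : k.-tuple (measurableTypeR R) -> RX R X).
  apply: measurable_fun_RX => x; apply: measurable_funD => //.
  apply: measurable_sum => i; apply: measurable_funM => //.
  exact: measurable_tnth.
have mpre (C : set (RX R X)) : measurable C -> measurable (phi @^-1` C).
  by move=> mC; rewrite -[Y in measurable Y]setTI; exact: mphi.
pose g p := p x1 - p x2 - q.
have [t0 _ t0E] := Kphi _ Kp0; have [t1 _ t1E] := Kphi _ (Kswap _ Kp0).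
have g0 : g p0 != 0 by rewrite subr_eq0.
(* The swap moves p along the difference of the basis vectors at x1 and x2. This direction lies in
   the span of the chart because p0 and its image both lie in K and differ by [g p0] times it; v is
   its coordinate vector. *)
pose v := [tuple ((tnth t0 i : R) - tnth t1 i) / g p0 | i < k].
have phi_v x : \sum_(i < k) tnth v i * e i x = (x == x1)%:R - (x == x2)%:R.
  have E0 : c x + \sum_(i < k) tnth t0 i * e i x = p0 x by rewrite -t0E.
  have E1 : c x + \sum_(i < k) tnth t1 i * e i x =
      p0 x - g p0 * ((x == x1)%:R - (x == x2)%:R).
    by rewrite -[RHS]/(swap p0 x) -t1E.
  apply: (mulfI g0); rewrite mulr_sumr.
  have -> : \sum_(i < k) g p0 * (tnth v i * e i x) =
     \sum_(i < k) tnth t0 i * e i x - \sum_(i < k) tnth t1 i * e i x.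
    rewrite -sumrB; apply: eq_bigr => i _; rewrite tnth_mktuple.
    by field.
  lra.
(* The swap in coordinates: [phi] conjugates T to it. *)
pose T (t : k.-tuple (measurableTypeR R)) : k.-tuple (measurableTypeR R) :=
  [tuple (tnth t i : R) - g (phi t) * tnth v i | i < k].
have phiT t : phi (T t) = swap (phi t).
  apply/funext => x; rewrite /coord_swap -/(g _) -phi_v mulr_sumr {1}/phi.
  rewrite {2}/phi /affine_chart -addrA -sumrB; congr (_ + _); apply: eq_bigr => i _.
  by rewrite tnth_mktuple; ring.
have gswap p : g (swap p) = - g p.
  by rewrite /g coord_swap1 coord_swap2; ring.
have TK : involutive T.
  move=> t; apply/eq_from_tnth => i; rewrite tnth_mktuple phiT gswap tnth_mktuple.
  by ring.
have mT : measurable_fun setT T.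
  apply/measurable_fun_tnthP => i.
  rewrite (_ : _ \o _ = fun t => (tnth t i : R) - g (phi t) * tnth v i); last first.
    by apply/funext => t /=; rewrite tnth_mktuple.
  apply: measurable_funB; first exact: measurable_tnth.
  apply: measurable_funM => //; apply: measurable_funB => //.
  by apply: measurable_funB; apply: (measurableT_comp (measurable_RX_coord _) mphi).
(* [lin] is the linear part of [phi], and L below is the linear part of T. *)
pose lin (u : k.-tuple (measurableTypeR R)) x := \sum_(i < k) tnth u i * e i x.
pose L u : k.-tuple (measurableTypeR R) :=
  [tuple (tnth u i : R) - (lin u x1 - lin u x2) * tnth v i | i < k].
have TL u t : T (tuple_add u t) = tuple_add (L u) (T t).
  have phiD x : phi (tuple_add u t) x = lin u x + phi t x.
    rewrite /phi /affine_chart /lin addrCA -big_split /=; congr (_ + _).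
    by apply: eq_bigr => i _; rewrite tnth_mktuple mulrDl.
  apply/eq_from_tnth => i; rewrite !tnth_mktuple /g !phiD; ring.
have KT : T @^-1` (phi @^-1` K) = phi @^-1` K.
  apply/seteqP; split=> t /=; rewrite phiT; last exact: Kswap.
  by move=> /Kswap; rewrite coord_swapK.
have key C : measurable C -> lebesgue_tuple (T @^-1` C) = lebesgue_tuple C.
  rewrite lamE; apply: (@invariant_involution _ _ lam T L (phi @^-1` K)) => //.
  - by move=> u D mD; rewrite -lamE; exact: lebesgue_tuple_translation.
  - exact: mpre.
  - by rewrite -lamE.
have mswapB : measurable (swap @^-1` B : set (RX R X)).
  by rewrite -[Y in measurable Y]setTI; exact: measurable_coord_swap.
rewrite !muE //; congr (_ / _)%E.
rewrite -[RHS]key; last by apply: mpre; exact: measurableI.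
congr lebesgue_tuple; apply/seteqP; split=> t /=; rewrite phiT.
  by case=> Kt Bt; split=> //; exact: Kswap.
by case=> /Kswap; rewrite coord_swapK.
Qed.

(** The defining ratio depends on B only through its trace on K, so K has the same mass as the whole
    space. *)
Lemma uniform_on_full K (mu : probability (RX R X) R) :
  measurable (K : set (RX R X)) -> uniform_on K mu -> mu K = 1%E.
Proof.
move=> mK [k [c [e]]] [_ _ _ muE].
rewrite -(@probability_setT _ _ _ mu) !muE //.
by rewrite setIid setIT.
Qed.

Lemma bounded_coord_integrable K (mu : probability (RX R X) R) x :
  measurable (K : set (RX R X)) -> (forall p, K p -> 0 <= p x <= 1) ->
  mu.-integrable K (EFin \o (fun p : RX R X => p x)).
Proof.
move=> mK K01; apply: measurable_bounded_integrable => //.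
- by rewrite (le_lt_trans (probability_le1 mu mK)) // ltry.
- exact: measurable_funTS (measurable_RX_coord x).
- exists 1; split; first exact: num_real.
  move=> M M1 p Kp /=; have /andP[p0 p1] := K01 p Kp.
  by rewrite ger0_norm // (le_trans p1) // ltW.
Qed.

(** By invariance the mean of p x1 equals the mean of p x2 + q. Adding the mean of p x1 to both
    sides and using p x1 + p x2 <= 1 bounds twice this mean by 1 + q. *)
Lemma uniform_on_swap_mean K (mu : probability (RX R X) R) :
  measurable (K : set (RX R X)) -> (forall p x, K p -> 0 <= p x <= 1) ->
  (forall p, K p -> p x1 + p x2 <= 1) -> (forall p, K p -> K (swap p)) ->
  (exists2 p, K p & p x1 - p x2 != q) -> uniform_on K mu ->
  \int[mu]_(p in K) p x1 <= (1 + q) / 2.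
Proof.
move=> mK K01 Ksum Kswap Kne Kmu.
have i1 := bounded_coord_integrable mu mK (fun p => K01 p x1).
have i2 := bounded_coord_integrable mu mK (fun p => K01 p x2).
have iq c : mu.-integrable K (EFin \o (fun _ : RX R X => c)).
  exact: finite_measure_integrable_cst.
have KE : (swap : RX R X -> RX R X) @^-1` K = K.
  by apply/seteqP; split=> p /= /Kswap //; rewrite coord_swapK.
have i2q : mu.-integrable K (EFin \o (fun p : RX R X => p x2 + q)).
  by apply: eq_integrable (integrableD mK i2 (iq q)).
have m1 : measurable_fun setT (EFin \o (fun p : RX R X => p x1)).
  by apply/measurable_EFinP; exact: measurable_RX_coord.
have swapE : \int[mu]_(p in K) p x1 = \int[mu]_(p in K) (p x2 + q).
  congr fine.
  transitivity (\int[pushforward mu (swap : RX R X -> RX R X)]_(p in K) (p x1)%:E)%E.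
    pose nu : {measure set (RX R X) -> \bar R} :=
      pushforward_measure mu
        (measurable_coord_swap x1 x2 q).
    apply: (@eq_measure_integral _ _ _ _ nu) => B mB _.
    exact/esym/(uniform_on_swap mK Kswap Kne Kmu).
  rewrite integral_pushforward //.
  - by rewrite KE; apply: eq_integral => p _ /=; rewrite coord_swap1.
  - exact: measurable_coord_swap.
  - rewrite KE; apply: (eq_integrable mK (EFin \o (fun p : RX R X => p x2 + q))) => // p _ /=.
    by rewrite coord_swap1.
suff : \int[mu]_(p in K) p x1 + \int[mu]_(p in K) p x1 <= 1 + q by lra.
rewrite {2}swapE -RintegralD //.
apply: le_trans (_ : \int[mu]_(p in K) (1 + q) <= _).
  apply: le_Rintegral => //.
    by apply: eq_integrable (integrableD mK i1 i2q).
  by move=> p Kp; rewrite addrA lerD2r Ksum.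
by rewrite Rintegral_cst //= (uniform_on_full mK Kmu) mulr1.
Qed.

End Swap.

End UniformSwap.

(** * Moments of a binomial count *)

Section TupleMean.
Context {R : realType} {T : finType}.
Variable w : T -> R.

(** Expectation over n independent draws of law w. For w the law of expert trajectories, the product
    is [data_prob]. *)
Definition tuple_mean n (F : n.-tuple T -> R) : R :=
  \sum_(D : n.-tuple T) (\prod_(i < n) w (tnth D i)) * F D.

Lemma eq_tuple_mean n (F G : n.-tuple T -> R) :
  F =1 G -> tuple_mean F = tuple_mean G.
Proof. by move=> FG; apply: eq_bigr => D _; rewrite FG. Qed.

Lemma tuple_meanD n (F G : n.-tuple T -> R) :
  tuple_mean (fun D => F D + G D) = tuple_mean F + tuple_mean G.
Proof. by rewrite -big_split /=; apply: eq_bigr => D _; rewrite mulrDr. Qed.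

Lemma tuple_meanZ n c (F : n.-tuple T -> R) :
  tuple_mean (fun D => c * F D) = c * tuple_mean F.
Proof. by rewrite mulr_sumr; apply: eq_bigr => D _; rewrite mulrCA. Qed.

Lemma tuple_mean0 (F : 0.-tuple T -> R) : tuple_mean F = F [tuple].
Proof.
rewrite /tuple_mean (big_pred1 [tuple]) => [|D]; last exact/esym/eqP/tuple0.
by rewrite big_ord0 mul1r.
Qed.

(** Conditioning on the first draw; all moments below follow by induction from this recursion. *)
Lemma tuple_meanS n (F : n.+1.-tuple T -> R) :
  tuple_mean F = \sum_x w x * tuple_mean (fun D : n.-tuple T => F [tuple of x :: D]).
Proof.
transitivity (\sum_(xD : T * n.-tuple T)
    w xD.1 * ((\prod_(i < n) w (tnth xD.2 i)) * F [tuple of xD.1 :: xD.2])).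
  rewrite /tuple_mean (reindex (fun xD : T * n.-tuple T => [tuple of xD.1 :: xD.2])) /=.
    apply: eq_bigr => -[x D] _ /=; rewrite big_ord_recl tnth0 mulrA.
    by congr (_ * _ * _); apply: eq_bigr => i _; rewrite tnthS.
  exists (fun D => (thead D, [tuple of behead D])) => [[x D] _|D _] /=.
    by congr pair; apply/val_inj.
  by rewrite -tuple_eta.
rewrite -(pair_big xpredT xpredT (fun x (D : n.-tuple T) =>
    w x * ((\prod_(i < n) w (tnth D i)) * F [tuple of x :: D]))) /=.
by apply: eq_bigr => x _; rewrite -mulr_sumr.
Qed.

Hypothesis w_ge0 : forall x, 0 <= w x.
Hypothesis w_sum1 : \sum_x w x = 1.

Lemma le_tuple_mean n (F G : n.-tuple T -> R) :
  (forall D, F D <= G D) -> tuple_mean F <= tuple_mean G.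
Proof.
by move=> FG; apply: ler_sum => D _; rewrite ler_wpM2l // prodr_ge0.
Qed.

Lemma tuple_mean_cst n c : tuple_mean (fun _ : n.-tuple T => c) = c.
Proof.
elim: n => [|n IH]; first by rewrite tuple_mean0.
rewrite tuple_meanS; under eq_bigr do rewrite IH.
by rewrite -mulr_suml w_sum1 mul1r.
Qed.

Variable a : pred T.
Let p := \sum_x w x * (a x)%:R.
Let v := p * (1 - p).

Definition deviation n (D : n.-tuple T) : R := (count a D)%:R - n%:R * p.

Let y x : R := (a x)%:R - p.

Lemma sum_dev_poly (c0 c1 : R) : \sum_x w x * (c0 + c1 * (a x)%:R) = c0 + c1 * p.
Proof.
under eq_bigr do rewrite mulrDr [w _ * (c1 * _)]mulrCA.
by rewrite big_split /= -mulr_suml w_sum1 mul1r -mulr_sumr.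
Qed.

Lemma deviation_cons n x (D : n.-tuple T) :
  deviation [tuple of x :: D] = y x + deviation D.
Proof. by rewrite /deviation /y /= natrD -(natr1 n); ring. Qed.

(** A function of the boolean [a x] is affine in its indicator, so sums of powers of y reduce to
    [sum_dev_poly]. *)
Let yE : forall j x, y x ^+ j = (- p) ^+ j + ((1 - p) ^+ j - (- p) ^+ j) * (a x)%:R.
Proof. by move=> j x; rewrite /y; case: (a x) => /=; rewrite ?sub0r; ring. Qed.

Lemma deviation_mean1 n : tuple_mean (@deviation n) = 0.
Proof.
elim: n => [|n IH]; first by rewrite tuple_mean0 /deviation /=; ring.
rewrite tuple_meanS.
transitivity (\sum_x w x * y x).
  apply: eq_bigr => x _; congr (_ * _).
  rewrite (eq_tuple_mean (deviation_cons x)) tuple_meanD tuple_mean_cst IH.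
  by rewrite addr0.
under eq_bigr do rewrite -[y _]expr1 yE.
by rewrite sum_dev_poly; ring.
Qed.

Lemma deviation_mean2 n : tuple_mean (fun D : n.-tuple T => deviation D ^+ 2) = n%:R * v.
Proof.
elim: n => [|n IH]; first by rewrite tuple_mean0 /deviation /=; ring.
rewrite tuple_meanS.
transitivity (\sum_x w x * (y x ^+ 2 + n%:R * v)).
  apply: eq_bigr => x _; congr (_ * _).
  rewrite (@eq_tuple_mean _ _ (fun D => y x ^+ 2 + (2 * y x * deviation D + deviation D ^+ 2))).
    by rewrite !tuple_meanD tuple_mean_cst tuple_meanZ deviation_mean1 IH mulr0 add0r.
  by move=> D; rewrite deviation_cons; ring.
under eq_bigr do rewrite yE addrAC.
by rewrite sum_dev_poly -(natr1 n) /v; ring.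
Qed.

Hypothesis p01 : 0 <= p <= 1.

(** One more draw adds exactly 6 (n v) v + v (1 - 3 v) to the fourth moment, the last term being the
    fourth central moment of a single draw. The claimed bound grows by 6 v^2 more than that. *)
Lemma deviation_mean4 n :
  tuple_mean (fun D : n.-tuple T => deviation D ^+ 4) <= n%:R * v + 3 * (n%:R * v) ^+ 2.
Proof.
have v0 : 0 <= v by case/andP: p01 => ? ?; rewrite mulr_ge0 // subr_ge0.
elim: n => [|n IH]; first by rewrite tuple_mean0 /deviation /= !mul0r subrr expr0n /= expr0n /=; lra.
rewrite tuple_meanS.
set m4 := tuple_mean _ in IH.
(* The third moment stays symbolic: its coefficient is a multiple of the mean of y, so it
   cancels. *)
pose m3 := tuple_mean (fun D : n.-tuple T => deviation D ^+ 3).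
rewrite (_ : \sum_x _ = \sum_x w x * ((m4 + p ^+ 4 + 6 * p ^+ 2 * (n%:R * v) - 4 * p * m3) +
     ((1 - p) ^+ 4 - p ^+ 4 + 6 * ((1 - p) ^+ 2 - p ^+ 2) * (n%:R * v) + 4 * m3) * (a x)%:R)).
  rewrite sum_dev_poly.
  have -> : m4 + p ^+ 4 + 6 * p ^+ 2 * (n%:R * v) - 4 * p * m3 +
     ((1 - p) ^+ 4 - p ^+ 4 + 6 * ((1 - p) ^+ 2 - p ^+ 2) * (n%:R * v) + 4 * m3) * p =
     m4 + 6 * (n%:R * v) * v + v * (1 - 3 * v).
    by rewrite /v; ring.
  rewrite -(natr1 n); apply: le_trans (_ : n%:R * v + 3 * (n%:R * v) ^+ 2 +
     6 * (n%:R * v) * v + v * (1 - 3 * v) <= _); first by rewrite !lerD2r.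
  have vv : 0 <= v * v by rewrite mulr_ge0.
  by rewrite -subr_ge0 (_ : _ - _ = 6 * (v * v)); [lra | ring].
apply: eq_bigr => x _; congr (_ * _).
rewrite (@eq_tuple_mean _ _ (fun D => y x ^+ 4 + (4 * y x ^+ 3 * deviation D +
   (6 * y x ^+ 2 * deviation D ^+ 2 + (4 * y x * deviation D ^+ 3 + deviation D ^+ 4))))); last first.
  by move=> D; rewrite deviation_cons; ring.
rewrite !tuple_meanD tuple_mean_cst !tuple_meanZ deviation_mean1 deviation_mean2.
rewrite -/m4 -/m3 !yE /y; case: (a x); ring.
Qed.

(** The negative part of x is (|x| - x) / 2, and |x| has a minorant in x^2 and x^4. Taking means
    leaves only the second and fourth moments, as the deviation is centred. *)
Lemma shortfall_mean_large n : 1 / 4 <= n%:R * v ->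
  9 / 128 * Num.sqrt (n%:R * v) <=
  tuple_mean (fun D : n.-tuple T => Num.max 0 (- deviation D)).
Proof.
move=> nv; set s := Num.sqrt _.
have s2 : s ^+ 2 = n%:R * v by rewrite sqr_sqrtr //; lra.
have s0 : 0 < s by rewrite sqrtr_gt0; lra.
pose G (D : n.-tuple T) := (8 * s)^-1 * deviation D ^+ 2 +
   ((- (128 * s ^+ 3)^-1) * deviation D ^+ 4 + (- (1 / 2)) * deviation D).
apply: le_trans (_ : tuple_mean G <= _).
  rewrite /G !tuple_meanD !tuple_meanZ deviation_mean1 deviation_mean2 mulr0 addr0 -s2.
  have := deviation_mean4 n; rewrite -s2; set m := tuple_mean _ => m4.
  (* From s^2 >= 1/4 follows s^2 <= 4 s^4, so m <= s^2 + 3 s^4 <= 7 s^4. The constant of the lemma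
     is then 1/8 - 7/128 = 9/128. *)
  have m4' : m <= 7 * s ^+ 4 by nra.
  have : (128 * s ^+ 3)^-1 * m <= (128 * s ^+ 3)^-1 * (7 * s ^+ 4).
    by rewrite ler_wpM2l // invr_ge0 mulr_ge0 // exprn_ge0 // ltW.
  have -> : (128 * s ^+ 3)^-1 * (7 * s ^+ 4) = 7 / 128 * s by field; lra.
  have -> : (8 * s)^-1 * s ^+ 2 = 1 / 8 * s by field; lra.
  rewrite mulNr; lra.
apply: le_tuple_mean => D; rewrite /G; set x := deviation D.
(* |x| >= x^2 / l - x^4 / l^3 with l = 4 s, as t - t^3 <= 1 *)
have key : (8 * s)^-1 * x ^+ 2 + - (128 * s ^+ 3)^-1 * x ^+ 4 <= 1 / 2 * `|x|.
  have -> : (8 * s)^-1 * x ^+ 2 + - (128 * s ^+ 3)^-1 * x ^+ 4 =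
     1 / 2 * (`|x| * (`|x| / (4 * s) - (`|x| / (4 * s)) ^+ 3)).
    rewrite -[x ^+ 2]real_normK ?num_real // (_ : x ^+ 4 = `|x| ^+ 4); last first.
      by rewrite (exprM x 2 2) -[x ^+ 2]real_normK ?num_real // -exprM.
    by field; lra.
  apply: ler_wpM2l; first lra.
  set t := `|x| / _.
  have t0 : 0 <= t by rewrite /t divr_ge0 // mulr_ge0 // ltW.
  rewrite -[leRHS]mulr1 ler_wpM2l //.
  have t3 : 0 <= t ^+ 3 by rewrite exprn_ge0.
  have [t1|t1] := lerP t 1; first lra.
  have : t <= t ^+ 3 by rewrite ler_eXnr // ltW.
  lra.
rewrite le_max; case: (lerP 0 x) => hx; apply/orP; [left|right].
  by rewrite ger0_norm // in key; lra.
by rewrite ltr0_norm // in key; lra.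
Qed.

(** The shortfall dominates n p (1 - count): both equal n p at count 0, and the latter is
    nonpositive at positive counts. Its mean is n p (1 - n p) >= n p / 2. *)
Lemma shortfall_mean_small n : n%:R * p <= 1 / 2 ->
  n%:R * p / 2 <= tuple_mean (fun D : n.-tuple T => Num.max 0 (- deviation D)).
Proof.
move=> np; have np0 : 0 <= n%:R * p by rewrite mulr_ge0 //; case/andP: p01.
apply: le_trans (_ : tuple_mean (fun D : n.-tuple T => n%:R * p * (1 - n%:R * p) + - (n%:R * p) * deviation D) <= _).
  by rewrite tuple_meanD tuple_mean_cst tuple_meanZ deviation_mean1; nra.
apply: le_tuple_mean => D; rewrite /deviation le_max.
case: (count a D) => [|m]; apply/orP; [right|left]; first by rewrite sub0r; lra.
have m0 : 0 <= m%:R :> R by [].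
rewrite -natr1; nra.
Qed.

End TupleMean.

(** * VAIL in the absorbing MDP *)

Section AbsorbingMDP.
Context {R : realType} {S A : finType} {H : nat}.
Variables (a1 : A) (S_gt0 : (0 < #|S|)%N).

Let rho : R := #|S|%:R^-1.

Lemma dirac_is_distr (s : S) : is_distr (fun s' : S => (s' == s)%:R : R).
Proof.
split=> [x|]; first exact: ler0n.
by rewrite (bigD1 s) //= eqxx big1 ?addr0 // => i /negPf ->.
Qed.

Lemma uniform_is_distr : is_distr (fun _ : S => rho).
Proof.
split=> [_|]; first by rewrite invr_ge0.
by rewrite sumr_const -mulr_natl divff // pnatr_eq0 -lt0n.
Qed.

Lemma indicator_01 (b : bool) : 0 <= (b%:R : R) <= 1.
Proof. by case: b; rewrite ?lexx ler01. Qed.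

Definition absorbing_mdp : mdp R S A H :=
  @MDP R S A H (fun _ s _ s' => (s' == s)%:R) (fun _ _ a => (a == a1)%:R)
    (fun _ => rho) (fun _ s _ => dirac_is_distr s)
    (fun _ _ a => indicator_01 (a == a1)) uniform_is_distr.

Definition expert : 'I_H -> S -> A := fun _ _ => a1.

Lemma absorbing_standard_imitation : standard_imitation absorbing_mdp expert.
Proof.
split=> [h s a|]; first by rewrite /= eqxx.
by exists a1 => h s; split=> //= [|a /negPf ->]; rewrite ?eqxx.
Qed.

Lemma expert_is_policy : is_policy (det_policy R expert).
Proof.
move=> h s; split=> [a|]; first exact: ler0n.
by rewrite (bigD1 a1) //= eqxx big1 ?addr0 // => i /negPf ->.
Qed.

End AbsorbingMDP.

(** * Occupancies, values and VAIL solutions in the absorbing MDP *)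

Section Occupancy.
Context {R : realType} {S A : finType} {H : nat}.
Variables (a1 : A) (S_gt0 : (0 < #|S|)%N).
Local Notation M := (@absorbing_mdp R S A H.+1 a1 S_gt0).
Local Notation rho := (#|S|%:R^-1 : R).
Implicit Types (pi : policy R S A H.+1) (t : traj S A H.+1).

(** Only the initial state of t contributes to the sum over s. The point of this form is that for
    fixed s it is a product over steps, so sums over trajectories factor. *)
Lemma traj_prob_absorbing pi t :
  traj_prob M pi t = \sum_s rho *
    \prod_h (((t h).1 == s)%:R * pi (h, s, (t h).2)).
Proof.
set s0 := (t ord0).1.
rewrite (bigD1 s0) //= [X in _ = _ + X]big1 ?addr0; last first.
  by move=> s s0s; rewrite (bigD1 ord0) //= eq_sym (negPf s0s) !mul0r mulr0.
rewrite /traj_prob /= (big_pred1 ord0) //.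
have [st|nst] := boolP [forall h, (t h).1 == s0].
  rewrite [X in _ * X]big1 ?mulr1 => [|h _].
    congr (_ * _); apply: eq_bigr => h _.
    by rewrite (eqP (forallP st h)) eqxx mul1r.
  by rewrite big1 // => h' _; rewrite !(eqP (forallP st _)) eqxx.
(* If all transition factors were nonzero, induction on h would keep t in its first state. *)
rewrite [X in _ * X](_ : _ = 0); last first.
  apply/eqP; apply: contraNT nst => nz; apply/forallP => -[h hH].
  elim: h hH => [|h IH] hH; first by rewrite /s0; apply/eqP; congr (_ (t _)); apply: val_inj.
  rewrite -(eqP (IH (ltnW hH))).
  move/prodf_neq0: nz => /(_ (Ordinal (ltnW hH)) isT) /prodf_neq0 /(_ (Ordinal hH)).
  by move=> /= /(_ (eqxx _)); rewrite pnatr_eq0 eqb0 negbK.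
rewrite mulr0; move: nst; rewrite negb_forall => /existsP[h hs].
by rewrite (bigD1 h) //= (negPf hs) !mul0r mulr0.
Qed.

Lemma policy_sum1 pi h s s' : is_policy pi ->
  \sum_(y : S * A) ((y.1 == s)%:R * pi (h, s, y.2)) * (s' == s)%:R = (s' == s)%:R.
Proof.
move=> pol; rewrite -mulr_suml.
rewrite -(pair_big xpredT xpredT (fun x a => (x == s)%:R * pi (h, s, a))) /=.
rewrite (bigD1 s) //= [X in _ + X]big1 ?addr0; last first.
  by move=> x /negPf xs; rewrite big1 // => a _; rewrite xs mul0r.
by under eq_bigr do rewrite eqxx mul1r; rewrite (pol h s).2 mul1r.
Qed.

Lemma occupancy_absorbing pi h s a : is_policy pi ->
  occupancy M pi h s a = rho * pi (h, s, a).
Proof.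
move=> pol; rewrite /occupancy.
under eq_bigr do rewrite traj_prob_absorbing.
rewrite exchange_big /=.
(* The constraint on step h becomes a factor that is 1 at all other steps. Distributing the sum over
   trajectories, each of these other steps sums to 1. *)
pose F s' h' (y : S * A) : R :=
  ((h' == h) ==> (y == (s, a)))%:R * ((y.1 == s')%:R * pi (h', s', y.2)).
transitivity (\sum_s' rho * \prod_h' \sum_y F s' h' y).
  apply: eq_bigr => s' _; rewrite -mulr_sumr; congr (_ * _).
  rewrite bigA_distr_bigA /= big_mkcond /=; apply: eq_bigr => t _.
  rewrite [RHS]big_split /=; case: ifPn => [/eqP th|th].
    rewrite [X in _ = X * _]big1 ?mul1r // => h' _.
    by case: eqP => [->|] //; rewrite th eqxx.
  by rewrite [X in _ = X * _](bigD1 h) //= eqxx (negPf th) !mul0r.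
rewrite -mulr_sumr; congr (_ * _).
rewrite (bigD1 s) //= [X in _ + X]big1 ?addr0 => [|s' s's]; last first.
  rewrite (bigD1 h) //= big1 ?mul0r // => y _; rewrite /F eqxx /=.
  by case: eqP => [->|_]; rewrite ?mul0r //= eq_sym (negPf s's) mul0r mulr0.
rewrite (bigD1 h) //= [X in _ * X]big1 ?mulr1 => [|h' /negPf h'h].
  rewrite (bigD1 (s, a)) //= /F !eqxx /= !mul1r big1 ?addr0 // => y /negPf ->.
  by rewrite mul0r.
transitivity ((s == s)%:R : R); last by rewrite eqxx.
rewrite -[RHS](policy_sum1 h' s s pol) /F h'h eqxx /=.
by apply: eq_bigr => y _; rewrite mul1r mulr1.
Qed.

Lemma occupancy_total (M' : mdp R S A H.+1) pi (F : S * A -> R) h :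
  \sum_t traj_prob M' pi t * F (t h) = \sum_sa F sa * occupancy M' pi h sa.1 sa.2.
Proof.
rewrite (partition_big (fun t : traj S A H.+1 => t h) xpredT) //=.
apply: eq_bigr => sa _; rewrite /occupancy mulr_sumr -surjective_pairing.
by apply: eq_bigr => t /eqP ->; rewrite mulrC.
Qed.

Lemma traj_prob_ge0 pi t : is_policy pi -> 0 <= traj_prob M pi t.
Proof.
move=> pol; rewrite traj_prob_absorbing; apply: sumr_ge0 => s _.
rewrite mulr_ge0 ?invr_ge0 //; apply: prodr_ge0 => h _.
by rewrite mulr_ge0 //; exact: (pol h s).1.
Qed.

Lemma traj_prob_sum1 pi : is_policy pi -> \sum_t traj_prob M pi t = 1.
Proof.
move=> pol; under eq_bigr do rewrite -[traj_prob _ _ _]mulr1.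
rewrite (occupancy_total M pi (fun=> 1) ord0).
under eq_bigr do rewrite mul1r occupancy_absorbing //.
rewrite -(pair_big xpredT xpredT (fun s a => rho * pi (ord0, s, a))) /=.
under eq_bigr do rewrite -mulr_sumr (pol _ _).2 mulr1.
exact: (uniform_is_distr S_gt0).2.
Qed.

Lemma value_absorbing pi : is_policy pi ->
  value M pi = \sum_h \sum_s rho * pi (h, s, a1).
Proof.
move=> pol; rewrite /value; under eq_bigr do rewrite mulr_sumr.
rewrite exchange_big; apply: eq_bigr => h _.
rewrite (occupancy_total M pi (fun sa => reward M h sa.1 sa.2)) /=.
rewrite -(pair_big xpredT xpredT (fun s a => (a == a1)%:R * occupancy M pi h s a)) /=.
apply: eq_bigr => s _; rewrite (bigD1 a1) //= eqxx mul1r occupancy_absorbing //.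
by rewrite big1 ?addr0 // => a /negPf ->; rewrite mul0r.
Qed.

(** A trajectory with a non-expert action has probability zero under the expert, so it cannot occur
    in data of nonzero probability. *)
Lemma empirical_nonexpert n (D : n.-tuple (traj S A H.+1)) h s a :
  data_prob M (det_policy R (@expert S A H.+1 a1)) D != 0 -> a != a1 ->
  empirical R D h s a = 0.
Proof.
move=> /prodf_neq0 D0 aa1; rewrite /empirical.
rewrite (_ : count _ _ = 0%N) ?mul0r //; apply/eqP; rewrite -leqn0 leqNgt -has_count.
apply/negP => /hasP[t /tnthP[i ->]] /eqP th.
have := D0 i isT; rewrite traj_prob_absorbing => /negP; apply; apply/eqP.
apply: big1 => s' _; rewrite (bigD1 h) //= th /=.
by rewrite (negPf aa1) !mulr0 mul0r mulr0.
Qed.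

Lemma vail_loss_absorbing n (D : n.-tuple (traj S A H.+1)) pi :
  is_policy pi ->
  (forall h s a, a != a1 -> empirical R D h s a = 0) ->
  vail_loss M D pi = \sum_h \sum_s
    (`|rho * pi (h, s, a1) - empirical R D h s a1| + rho * (1 - pi (h, s, a1))).
Proof.
move=> pol D0; apply: eq_bigr => h _.
rewrite -(pair_big xpredT xpredT (fun s a =>
   `|occupancy M pi h s a - empirical R D h s a|)) /=.
apply: eq_bigr => s _; rewrite (bigD1 a1) //= occupancy_absorbing //; congr (_ + _).
rewrite -[X in X - _](pol h s).2 [X in X - _](bigD1 a1) //= addrAC subrr add0r mulr_sumr.
apply: eq_bigr => a aa1; rewrite D0 // subr0 occupancy_absorbing //.
rewrite ger0_norm //; apply: mulr_ge0; first by rewrite invr_ge0.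
exact: (pol h s).1.
Qed.

Lemma policy_le1 pi h s a : is_policy pi -> pi (h, s, a) <= 1.
Proof.
move=> pol; rewrite -(pol h s).2 (bigD1 a) //= lerDl.
by apply: sumr_ge0 => b _; exact: (pol h s).1.
Qed.

(** By the triangle inequality each (h, s) term is at least |rho - e|. Equality holds when rho *
    pi(a1) >= e or pi(a1) = 1, which is the [min] condition. The expert attains all these bounds at
    once, so a minimizer must attain each of them. *)
Lemma vail_solutions_absorbing n (D : n.-tuple (traj S A H.+1)) :
  (forall h s a, a != a1 -> empirical R D h s a = 0) ->
  vail_solutions M D = [set pi | is_policy pi /\
    forall h s, Num.min rho (empirical R D h s a1) <= rho * pi (h, s, a1)].
Proof.
move=> D0; set e := empirical R D.
have rho_ge0 : 0 <= rho by rewrite invr_ge0.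
pose L pi h s := `|rho * pi (h, s, a1) - e h s a1| + rho * (1 - pi (h, s, a1)).
have L_ge pi h s : is_policy pi -> `|rho - e h s a1| <= L pi h s.
  move=> pol; have p1 := policy_le1 h s a1 pol; rewrite /L.
  have pp : 0 <= rho * (1 - pi (h, s, a1)) by rewrite mulr_ge0 // subr_ge0.
  rewrite -[rho * (1 - _)]ger0_norm //.
  apply: (le_trans _ (ler_normD _ _)); rewrite le_eqVlt; apply/orP; left; apply/eqP.
  by congr `|_|; ring.
have L_eq pi h s : is_policy pi -> (L pi h s = `|rho - e h s a1|) <->
    Num.min rho (e h s a1) <= rho * pi (h, s, a1).
  move=> pol; have p1 := policy_le1 h s a1 pol; rewrite /L.
  have pp : 0 <= rho * (1 - pi (h, s, a1)) by rewrite mulr_ge0 // subr_ge0.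
  move: pp; rewrite mulrBr mulr1; set x := rho * pi _; set f := e _ _ _ => pp.
  by rewrite ge_min; split=> [|/orP[] ?]; do 2 (case: ger0P => ?); lra.
have lossE pi : is_policy pi -> vail_loss M D pi = \sum_h \sum_s L pi h s.
  by move=> pol; rewrite vail_loss_absorbing.
have expP := @expert_is_policy R S A H.+1 a1.
have expL h s : L (det_policy R (@expert S A H.+1 a1)) h s = `|rho - e h s a1|.
  by rewrite /L /= eqxx mulr1 subrr mulr0 addr0.
apply/seteqP; split=> pi [pol].
  move=> /(_ _ expP); rewrite !lossE // => le; split=> // h s; apply/L_eq => //.
  have dge h' : 0 <= \sum_s' (L pi h' s' - `|rho - e h' s' a1|).
    by apply: sumr_ge0 => s' _; rewrite subr_ge0 L_ge.
  (* The excesses over the bounds are nonnegative and their total is at most 0, so each vanishes. *)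
  have : \sum_h' \sum_s' (L pi h' s' - `|rho - e h' s' a1|) == 0.
    rewrite eq_le; apply/andP; split; last exact: sumr_ge0.
    under eq_bigr do rewrite sumrB; rewrite sumrB subr_le0; apply: le_trans le _.
    by apply: ler_sum => h' _; apply: ler_sum => s' _; rewrite expL.
  rewrite psumr_eq0 // => /allP /(_ h (mem_index_enum _)) /=.
  rewrite psumr_eq0 => [/allP /(_ s (mem_index_enum _)) /=|s' _].
    by rewrite subr_eq0 => /eqP.
  by rewrite subr_ge0 L_ge.
move=> le; split=> // pi' pol'; rewrite !lossE //.
apply: ler_sum => h _; apply: ler_sum => s _.
by have /L_eq -> := le h s; rewrite // L_ge.
Qed.

End Occupancy.

(** * Auxiliary facts on measurability and integration *)

Lemma measurable_forall_fin d (T : measurableType d) (I : finType) (P : I -> set T) :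
  (forall i, measurable (P i)) -> measurable [set t | forall i, P i t].
Proof.
move=> mP; rewrite (_ : [set t | _] = \bigcap_(i in setT) P i).
  by apply: fin_bigcap_measurable => //; exact: finite_finset.
by apply/seteqP; split=> t /= Pt i; [move=> _; exact: Pt | exact: Pt].
Qed.

Lemma Rintegral_full_measure d (T : measurableType d) (R : realType)
    (mu : probability T R) (K : set T) (f : T -> R) :
  measurable K -> mu K = 1%E -> measurable_fun setT f ->
  \int[mu]_x f x = \int[mu]_(x in K) f x.
Proof.
move=> mK K1 mf; have mKC : measurable (~` K) by exact: measurableC.
have muKC : mu (~` K) = 0%E by rewrite probability_setC // K1 subee.
rewrite /Rintegral; congr fine; rewrite -(setUv K) integral_setU //.
- rewrite [X in (_ + X)%E](@null_set_integral _ _ _ mu) ?adde0 //.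
  by apply: measurable_funTS; exact/measurable_EFinP.
- by rewrite setUv; exact/measurable_EFinP.
- by rewrite disj_set2E setICr.
Qed.

Lemma Rintegral_sum d (T : measurableType d) (R : realType)
    (mu : {measure set T -> \bar R}) (D : set T) (I : Type) (r : seq I)
    (f : I -> T -> R) :
  measurable D -> (forall i, mu.-integrable D (EFin \o f i)) ->
  \int[mu]_(x in D) (\sum_(i <- r) f i x) = \sum_(i <- r) \int[mu]_(x in D) f i x.
Proof.
move=> mD fi; have sumE s x : (\sum_(i <- s) f i x)%:E = (\sum_(i <- s) (f i x)%:E)%E.
  by rewrite sumEFin.
elim: r => [|i r IH].
  under eq_Rintegral do rewrite big_nil; rewrite big_nil.
  by rewrite Rintegral_cst // mul0r.
under eq_Rintegral do rewrite big_cons; rewrite big_cons RintegralD ?IH //.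
apply: eq_integrable (integrable_sum mD r (P := xpredT) (fun i _ => fi i)) => //.
by move=> x _ /=; rewrite sumE.
Qed.

(** * The polytope of VAIL solutions and the mean value over it *)

Section VailRegion.
Context {R : realType} {S A : finType} {H : nat}.
Variables (a1 : A) (S_gt0 : (0 < #|S|)%N).
Local Notation M := (@absorbing_mdp R S A H.+1 a1 S_gt0).
Local Notation rho := (#|S|%:R^-1 : R).
Local Notation index := ('I_H.+1 * S * A)%type.

Definition vail_region (f : 'I_H.+1 -> S -> R) : set (policy R S A H.+1) :=
  [set pi | is_policy pi /\ forall h s, f h s <= rho * pi (h, s, a1)].

Lemma measurable_vail_region f : measurable (vail_region f : set (RX R index)).
Proof.
have mle (g1 g2 : RX R index -> R) : measurable_fun setT g1 ->
    measurable_fun setT g2 -> measurable [set p | g1 p <= g2 p].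
  by move=> m1 m2; rewrite -[X in measurable X]setTI; exact: measurable_fun_le.
have mc (x : index) := @measurable_RX_coord R index x.
have mpol : measurable ([set p | is_policy p] : set (RX R index)).
  apply: measurable_forall_fin => h; apply: measurable_forall_fin => s.
  have mnneg : measurable ([set p | forall a, 0 <= p (h, s, a)] : set (RX R index)).
    by apply: measurable_forall_fin => a; apply: mle => //; exact: mc.
  have msum : measurable ([set p | \sum_a p (h, s, a) = 1] : set (RX R index)).
    rewrite (_ : mkset _ = [set p : RX R index | \sum_a p (h, s, a) <= 1] `&`
                           [set p | 1 <= \sum_a p (h, s, a)]); last first.
      by apply/seteqP; split=> p /= => [->|[]]; [rewrite lexx | move=> ? ?; lra].
    by apply: measurableI; apply: mle => //; apply: measurable_sum => ?; exact: mc.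
  exact: (measurableI _ _ mnneg msum).
have mbound : measurable ([set p | forall h s, f h s <= rho * p (h, s, a1)] : set (RX R index)).
  do 2 apply: measurable_forall_fin => ?.
  by apply: mle => //; apply: measurable_funM => //; exact: mc.
exact: (measurableI _ _ mpol mbound).
Qed.

Lemma measurable_value :
  measurable_fun setT (fun pi : RX R index => value M pi).
Proof.
apply: measurable_sum => t; apply: measurable_funM => //.
apply: measurable_funM => //; apply: measurable_funM => //.
by apply: measurable_prod => h _; exact: measurable_RX_coord.
Qed.

Lemma vail_region_01 f p x : vail_region f p -> 0 <= p x <= 1.
Proof.
case: x => -[h s] a [pol _]; apply/andP; split; first exact: (pol h s).1.
exact: policy_le1.
Qed.

Lemma expert_vail_region f : (forall h s, f h s <= rho) ->
  vail_region f (det_policy R (@expert S A H.+1 a1)).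
Proof.
move=> frho; split; first exact: expert_is_policy.
by move=> h s; rewrite /= eqxx mulr1.
Qed.

Let rho_gt0 : 0 < rho. Proof. by rewrite invr_gt0 ltr0n. Qed.

(** With q = f h s / rho the lower bound on pi_h(a1|s), the swap exchanges the two nonnegative
    numbers p x1 - q and p x2. It keeps the total mass of each state. *)
Lemma vail_region_swap f h s a2 p : a1 != a2 -> vail_region f p -> 0 <= f h s ->
  vail_region f (coord_swap (h, s, a1) (h, s, a2) (f h s / rho) p).
Proof.
move=> a12 [pol fp] f0; set x1 := (h, s, a1); set x2 := (h, s, a2).
have x12 : x1 != x2 by apply: contra a12 => /eqP[->].
set q := f h s / rho.
have q0 : 0 <= q by rewrite divr_ge0 // ltW.
have fq : f h s = rho * q by rewrite /q mulrC divfK ?gt_eqF.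
have qp : q <= p x1 by rewrite -(ler_pM2l rho_gt0) -fq.
split=> [h' s'|h' s'].
  split=> [a|].
    have [->|n1] := eqVneq (h', s', a) x1.
      by rewrite coord_swap1 // addr_ge0 //; exact: (pol h s).1.
    have [->|n2] := eqVneq (h', s', a) x2; first by rewrite coord_swap2 // subr_ge0.
    by rewrite coord_swap_other //; exact: (pol h' s').1.
  rewrite /coord_swap sumrB -mulr_sumr sumrB (pol h' s').2.
  have deltaE b : \sum_a ((h', s', a) == (h, s, b))%:R = ((h', s') == (h, s))%:R :> R.
    rewrite (bigD1 b) //= big1 ?addr0 => [|a /negPf ab].
      by rewrite !xpair_eqE eqxx andbT.
    by rewrite !xpair_eqE ab andbF.
  by rewrite !deltaE subrr mulr0 subr0.
have [e1|n1] := eqVneq (h', s', a1) x1.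
  rewrite e1 coord_swap1 //; case: e1 => -> ->; rewrite mulrDr -fq lerDr.
  by rewrite mulr_ge0 ?(ltW rho_gt0) //; exact: (pol h s).1.
rewrite coord_swap_other //; apply/negP => /eqP[_ _ a1a2].
by rewrite a1a2 eqxx in a12.
Qed.

Lemma vail_region_mean f (mu : policy_law R S A H.+1) h s :
  (1 < #|A|)%N -> (forall h s, 0 <= f h s <= rho) -> uniform_on (vail_region f) mu ->
  \int[mu]_(p in vail_region f) p (h, s, a1) <= (1 + f h s / rho) / 2.
Proof.
move=> A2 frho Kmu; have mK := measurable_vail_region f.
have [f0 f1] := andP (frho h s).
(* If q >= 1, then (1 + q) / 2 >= 1 and the bound is trivial. Otherwise the expert is a point that
   the swap moves, since there p x1 - p x2 = 1 differs from q. *)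
have [q1|q1] := leP 1 (f h s / rho).
  apply: le_trans (_ : \int[mu]_(p in vail_region f) 1 <= _).
    apply: le_Rintegral => //.
    - apply: bounded_coord_integrable => // p Kp.
      exact: (vail_region_01 _ Kp).
    - exact: finite_measure_integrable_cst.
    - by move=> p /(vail_region_01 (h, s, a1)) /andP[].
  by rewrite Rintegral_cst //= (uniform_on_full mK Kmu) mulr1; lra.
have [a2 a12] : exists a2, a1 != a2.
  have : (0 < #|[pred a | a1 != a]|)%N.
    have := cardC1 a1; rewrite (eq_card (B := [pred a | a1 != a])) => [->|a].
      by rewrite -subn1 subn_gt0.
    by rewrite !inE eq_sym.
  by case/card_gt0P => a2; exists a2.
have x12 : (h, s, a1) != (h, s, a2) by apply: contra a12 => /eqP[->].
apply: (uniform_on_swap_mean x12 mK _ _ _ _ Kmu) => [p x|p [pol _]|p Kp|].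
- exact: vail_region_01.
- rewrite -(pol h s).2 (bigD1 a1) //= (bigD1 a2) //=; last by rewrite eq_sym.
  by rewrite addrA lerDl; apply: sumr_ge0 => a _; exact: (pol h s).1.
- exact: vail_region_swap.
exists (det_policy R (@expert S A H.+1 a1)).
  by apply: expert_vail_region => h' s'; case/andP: (frho h' s').
by rewrite /= eqxx [a2 == _]eq_sym (negPf a12) subr0 gt_eqF.
Qed.

Lemma vail_region_value f (mu : policy_law R S A H.+1) :
  (1 < #|A|)%N -> (forall h s, 0 <= f h s <= rho) -> uniform_on (vail_region f) mu ->
  \int[mu]_p value M p <= \sum_h \sum_s (rho + f h s) / 2.
Proof.
move=> A2 frho Kmu; have mK := measurable_vail_region f.
rewrite (Rintegral_full_measure mK (uniform_on_full mK Kmu) measurable_value).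
have ci (x : index) : mu.-integrable (vail_region f) (EFin \o (fun p : RX R index => p x)).
  by apply: bounded_coord_integrable => // p; exact: vail_region_01.
have cir (x : index) : mu.-integrable (vail_region f)
    (EFin \o (fun p : RX R index => rho * p x)).
  by apply: eq_integrable (integrableZl mK rho (ci x)).
have -> : \int[mu]_(p in vail_region f) value M p =
    \int[mu]_(p in vail_region f) (\sum_h \sum_s rho * p (h, s, a1)).
  by apply: eq_Rintegral => p /set_mem[pol _]; exact: value_absorbing.
rewrite Rintegral_sum // => [|h]; last first.
  apply: eq_integrable (integrable_sum mK (index_enum S) (P := xpredT)
     (fun s _ => cir (h, s, a1))) => // p _ /=.
  by rewrite sumEFin.
apply: ler_sum => h _; rewrite Rintegral_sum //.
apply: ler_sum => s _; rewrite RintegralZl //.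
have := vail_region_mean h s A2 frho Kmu; rewrite -(ler_pM2l rho_gt0).
move=> /le_trans; apply; rewrite mulrA mulrDr mulr1 [rho * (_ / _)]mulrC divfK //.
by rewrite gt_eqF.
Qed.

End VailRegion.

(** * From the expected shortfall to the sample size *)

Section SampleComplexity.
Context {R : realType} {S A : finType} {H : nat}.
Variables (a1 : A) (S_gt0 : (0 < #|S|)%N).
Local Notation M := (@absorbing_mdp R S A H.+1 a1 S_gt0).
Local Notation rho := (#|S|%:R^-1 : R).
Local Notation piE := (det_policy R (@expert S A H.+1 a1)).

Let rho_gt0 : 0 < rho. Proof. by rewrite invr_gt0 ltr0n. Qed.

Definition expert_visit (h : 'I_H.+1) (s : S) : pred (traj S A H.+1) :=
  fun t => t h == (s, a1).

Lemma expert_visit_prob h s :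
  \sum_t traj_prob M piE t * (expert_visit h s t)%:R = rho.
Proof.
rewrite (occupancy_total M piE (fun sa => (sa == (s, a1))%:R) h) (bigD1 (s, a1)) //=.
rewrite eqxx mul1r big1 ?addr0 => [|sa /negPf ->]; last by rewrite mul0r.
rewrite occupancy_absorbing /= ?eqxx ?mulr1 //.
exact: expert_is_policy.
Qed.

(** On given data the gap is at least the sum of (rho - min(rho, e)) / 2, that is, of half the
    positive part of rho - e. As rho - e is minus the deviation divided by n, the denominator is 2
    n. *)
Lemma vail_gap n (alg : n.-tuple (traj S A H.+1) -> policy_law R S A H.+1) :
  (1 < #|A|)%N -> (0 < n)%N -> is_vail M alg ->
  \sum_h \sum_s tuple_mean (traj_prob M piE)
    (fun D : n.-tuple _ => Num.max 0 (- deviation (traj_prob M piE) (expert_visit h s) D))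
    / (2 * n%:R) <=
  value M piE - expected_value M piE alg.
Proof.
move=> A2 n0 vail; have nR : 0 < n%:R :> R by rewrite ltr0n.
have piEP := @expert_is_policy R S A H.+1 a1.
pose f (D : n.-tuple (traj S A H.+1)) h s := Num.min rho (empirical R D h s a1).
have f01 D h s : 0 <= f D h s <= rho.
  rewrite /f le_min ge_min lexx andbT (ltW rho_gt0) /=.
  by rewrite divr_ge0.
have prob_ge0 D : 0 <= data_prob M piE D :> R.
  by apply: prodr_ge0 => i _; exact: traj_prob_ge0.
have le_exp : expected_value M piE alg <=
    tuple_mean (traj_prob M piE) (fun D => \sum_h \sum_s (rho + f D h s) / 2).
  (* Data of probability zero contribute nothing; on all other data the solution set is a
     [vail_region]. *)
  apply: ler_sum => D _; have [D0|D0] := eqVneq (data_prob M piE D) 0.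
    by rewrite [\prod_(_ < _) _]D0 D0 !mul0r.
  apply: ler_wpM2l => //; apply: vail_region_value => //.
  have := vail D; rewrite vail_solutions_absorbing // => h s a.
  exact: empirical_nonexpert.
apply: le_trans (lerB (lexx _) le_exp).
have -> : value M piE = tuple_mean (traj_prob M piE) (fun D : n.-tuple _ => \sum_(h < H.+1) \sum_(s : S) rho).
  rewrite tuple_mean_cst; last exact: traj_prob_sum1.
  rewrite value_absorbing //; apply: eq_bigr => h _; apply: eq_bigr => s _.
  by rewrite /= eqxx mulr1.
rewrite -[X in _ - X]mul1r -mulNr -tuple_meanZ -tuple_meanD.
under eq_bigr do under eq_bigr do rewrite mulrC -tuple_meanZ.
under eq_bigr do rewrite /tuple_mean exchange_big /=; rewrite exchange_big /=.
apply: ler_sum => D _; under eq_bigr do rewrite -mulr_sumr; rewrite -mulr_sumr.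
apply: ler_wpM2l; first exact: prob_ge0.
rewrite mulN1r -sumrB; apply: ler_sum => h _; rewrite -sumrB.
apply: ler_sum => s _.
rewrite /deviation expert_visit_prob /f /empirical -/(expert_visit h s).
set c := (count _ _)%:R.
have -> : - (c - n%:R * rho) = n%:R * (rho - c / n%:R).
  by rewrite mulrBr [n%:R * (c / _)]mulrCA divff ?gt_eqF // mulr1 opprB.
have [e|e] := lerP rho (c / n%:R).
  rewrite max_l; last by apply: mulr_ge0_le0; rewrite ?subr_le0 // ltW.
  rewrite mulr0; lra.
rewrite max_r; last by apply: mulr_ge0; rewrite ?subr_ge0 ltW.
rewrite mulrA invfM mulfVK; lra.
Qed.

(** The split is on the variance v = n rho (1 - rho) of a visit count. For v >= 1/4 the gap is of
    order H |S| sqrt(v) / n, and squaring gives the bound. For smaller v the gap is at least H / 4,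
    which contradicts eps <= H / 8. *)
Lemma vail_lower_bound n (alg : n.-tuple (traj S A H.+1) -> policy_law R S A H.+1)
    (eps : R) :
  (1 < #|S|)%N -> (1 < #|A|)%N -> (0 < n)%N -> is_vail M alg ->
  0 < eps <= 1 / 8 * H.+1%:R ->
  value M piE - expected_value M piE alg <= eps ->
  1 / 2048 * (#|S|%:R * H.+1%:R ^+ 2 / eps ^+ 2) <= n%:R.
Proof.
move=> S2 A2 n0 vail /andP[eps0 eps1] gap.
have nR : 0 < n%:R :> R by rewrite ltr0n.
have HR : 0 < H.+1%:R :> R by rewrite ltr0n.
have SR : 2 <= #|S|%:R :> R by rewrite ler_nat.
have rhoS : rho * #|S|%:R = 1 by rewrite mulVf // gt_eqF //; lra.
have rho_half : rho <= 1 / 2 by nra.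
have {}gap := le_trans (vail_gap A2 n0 vail) gap.
have piEP := @expert_is_policy R S A H.+1 a1.
have w0 t := @traj_prob_ge0 R S A H a1 S_gt0 _ t piEP.
have w1 := @traj_prob_sum1 R S A H a1 S_gt0 _ piEP.
have gapc c : (forall h s, c <= tuple_mean (traj_prob M piE)
    (fun D : n.-tuple _ => Num.max 0 (- deviation (traj_prob M piE) (expert_visit h s) D))) ->
    H.+1%:R * (#|S|%:R * (c / (2 * n%:R))) <= eps.
  move=> cle; apply: le_trans gap; rewrite -[H.+1 in X in X <= _]card_ord.
  rewrite !mulr_natl -!sumr_const; apply: ler_sum => h _; apply: ler_sum => s _.
  by rewrite ler_wpM2r // invr_ge0 mulr_ge0.
have rho01 : 0 <= rho <= 1 by apply/andP; split; [exact: ltW | lra].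
have [large|small] := leP (1 / 4) (n%:R * (rho * (1 - rho))).
  set v := n%:R * _ in large.
  have g : H.+1%:R * (#|S|%:R * (9 / 128 * Num.sqrt v / (2 * n%:R))) <= eps.
    apply: gapc => h s; have := @shortfall_mean_large _ _ _ w0 w1 (expert_visit h s).
    by rewrite expert_visit_prob => /(_ rho01 n); apply.
  have v2 : Num.sqrt v ^+ 2 = v by rewrite sqr_sqrtr //; lra.
  have {}g : H.+1%:R * #|S|%:R * (9 / 128 * Num.sqrt v) <= 2 * n%:R * eps.
    rewrite -subr_ge0 in g; rewrite -subr_ge0.
    rewrite (_ : _ - _ = 2 * n%:R * (eps - H.+1%:R *
      (#|S|%:R * (9 / 128 * Num.sqrt v / (2 * n%:R))))) ?mulr_ge0 //.
    by field; lra.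
  have {g} : (H.+1%:R * #|S|%:R * (9 / 128 * Num.sqrt v)) ^+ 2 <= (2 * n%:R * eps) ^+ 2.
    by rewrite ler_pXn2r // nnegrE !mulr_ge0 // ?sqrtr_ge0 // ltW.
  rewrite (_ : (_ * (9 / 128 * _)) ^+ 2 =
    81 / 16384 * (H.+1%:R ^+ 2 * #|S|%:R ^+ 2 * Num.sqrt v ^+ 2)); last by field.
  rewrite (_ : (2 * _ * _) ^+ 2 = 4 * (eps ^+ 2 * n%:R * n%:R)); last by ring.
  rewrite v2 => g.
  (* |S| >= 2 gives rho <= 1/2. Then H^2 |S| <= (131072 / 81) eps^2 n, and 131072 / 81 < 2048. *)
  have vle : 1 / 2 * (n%:R * rho) <= v.
    by rewrite /v mulrCA ler_pM2l // mulrC ler_pM2l //; lra.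
  have HS : H.+1%:R ^+ 2 * #|S|%:R ^+ 2 * (n%:R * rho) = H.+1%:R ^+ 2 * #|S|%:R * n%:R.
    by field; lra.
  have HS0 : 0 <= H.+1%:R ^+ 2 * #|S|%:R ^+ 2 :> R by rewrite mulr_ge0 // exprn_ge0.
  have := ler_wpM2l HS0 vle; rewrite mulrCA HS => {}vle.
  have {g vle} : H.+1%:R ^+ 2 * #|S|%:R * n%:R <= 2048 * eps ^+ 2 * n%:R * n%:R.
    have : 0 <= eps ^+ 2 * n%:R * n%:R by rewrite !mulr_ge0 // ltW.
    lra.
  rewrite ler_pM2r // => key.
  have -> : 1 / 2048 * (#|S|%:R * H.+1%:R ^+ 2 / eps ^+ 2) =
      (H.+1%:R ^+ 2 * #|S|%:R) / (2048 * eps ^+ 2) by field; rewrite gt_eqF.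
  have eps2 : 0 < 2048 * eps ^+ 2 by apply: mulr_gt0; [lra | exact: exprn_gt0].
  by rewrite (ler_pdivrMr _ _ eps2) [leRHS]mulrC; exact: key.
(* Again by rho <= 1/2, n rho / 2 is at most the variance, which is below 1/4. *)
have nrho : n%:R * rho <= 1 / 2.
  have : n%:R * rho * (1 / 2) <= n%:R * (rho * (1 - rho)).
    by rewrite -mulrA ler_pM2l // ler_pM2l //; lra.
  lra.
have g : H.+1%:R * (#|S|%:R * (n%:R * rho / 2 / (2 * n%:R))) <= eps.
  apply: gapc => h s; have := @shortfall_mean_small _ _ _ w0 w1 (expert_visit h s).
  by rewrite expert_visit_prob => /(_ rho01 n); apply.
have : H.+1%:R * (1 / 4) <= eps.
  apply: le_trans g; rewrite (_ : #|S|%:R * _ = rho * #|S|%:R * (1 / 4)) ?rhoS ?mul1r //.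
  by field; apply/andP; split; rewrite gt_eqF //; lra.
lra.
Qed.

End SampleComplexity.

Theorem proposition2 (R : realType) :
  exists c c0 : R, [/\ 0 < c, 0 < c0 &
    forall (S A : finType) (H : nat),
      (2 <= #|S|)%N -> (2 <= #|A|)%N -> (1 <= H)%N ->
      exists (M : mdp R S A H) (expert : 'I_H -> S -> A),
        standard_imitation M expert /\
        forall (eps : R) (n : nat)
               (alg : n.-tuple (traj S A H) -> policy_law R S A H),
          0 < eps <= c0 * H%:R -> (1 <= n)%N -> is_vail M alg ->
          value M (det_policy R expert) -
            expected_value M (det_policy R expert) alg <= eps ->
          c * (#|S|%:R * H%:R ^+ 2 / eps ^+ 2) <= n%:R].
Proof.
(* 1/2048 comes from squaring the large-variance bound; 1/8 lies below the constant 1/4 of the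
   small-variance gap. *)
exists (1 / 2048), (1 / 8); split; [lra | lra |].
move=> S A [//|H] S2 A2 _; have S0 : (0 < #|S|)%N by exact: leq_trans S2.
have [a1 _] : exists a1 : A, a1 \in A by apply/card_gt0P; exact: leq_trans A2.
exists (@absorbing_mdp R S A H.+1 a1 S0), (@expert S A H.+1 a1).
split; first exact: absorbing_standard_imitation.
by move=> eps n alg eps01 n1 vail; exact: vail_lower_bound.
Qed.
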